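(* For every positive integer $n$, $$\frac{\pi^{2n}}{(2n+1)!}=\sum_{\ell_n=n}^{\infty}\left(\sum_{\ell_{n-1}=n-1}^{\ell_n-1}\cdots\left(\sum_{\ell_2=2}^{\ell_3-1}\left(\sum_{\ell_1=1}^{\ell_2-1}\frac{1}{\ell_1^2\,\ell_2^2\cdots\ell_n^2}\right)\right)\cdots\right),$$ where the right-hand side consists of $n$ nested sums.
   Context: The summation indices $\ell_1,\dots,\ell_n$ are positive integers. The outermost index $\ell_n$ runs from $n$ to $\infty$. For $1\le j\le n-1$, the index $\ell_j$ runs from $j$ to $\ell_{j+1}-1$. For $n=1$ the right-hand side is $\sum_{\ell_1=1}^{\infty}1/\ell_1^2$; for $n=2$ it is $\sum_{\ell_2=2}^{\infty}\sum_{\ell_1=1}^{\ell_2-1}\frac{1}{\ell_1^2\ell_2^2}$. The infinite nested sum is defined as the limit, as $N\to\infty$, of the partial sums obtained by replacing the upper limit $\infty$ of the outermost sum by $N$ (with $N=n,n+1,n+2,\dots$). *)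

(* Defs.v *)
From mathcomp Require Import all_boot all_order all_algebra.
From mathcomp Require Import all_classical all_reals all_analysis.

Set Implicit Arguments.
Unset Strict Implicit.
Unset Printing Implicit Defensive.

Import Order.TTheory GRing.Theory Num.Theory.
Import numFieldNormedType.Exports.

Local Open Scope ring_scope.

(* nested_sum F j u [:: l_(j+1); ...; l_n] is
     sum_(l_j = j)^(u - 1) sum_(l_(j-1) = j-1)^(l_j - 1) ...
       sum_(l_1 = 1)^(l_2 - 1) F [:: l_1; ...; l_n] :
   the bound u is exclusive, and indices are accumulated outermost first. *)
Fixpoint nested_sum (R : realType) (F : seq nat -> R) (j u : nat)
    (ls : seq nat) : R :=
  if j is j'.+1 then \sum_(j <= l < u) nested_sum F j' l (l :: ls)
  else F ls.

Definition inv_prod_sq (R : realType) (ls : seq nat) : R :=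
  1 / \prod_(l <- ls) l%:R ^+ 2.

(* The outermost index l_n runs from n to N inclusive; the sum is empty
   when N < n, which does not affect the limit as N tends to infinity. *)
Definition partial_nested_sum (R : realType) (n N : nat) : R :=
  nested_sum (@inv_prod_sq R) n N.+1 [::].

(* Main.v *)
Require Import Defs.
From mathcomp Require Import all_boot all_order all_algebra.
From mathcomp Require Import all_classical all_reals all_analysis.
From mathcomp Require Import zify ring.
Import Order.TTheory GRing.Theory Num.Theory.
Import numFieldNormedType.Exports.
Local Open Scope classical_set_scope.
Local Open Scope ring_scope.

(** The truncation at N of the nested sum is the n-th elementary symmetric
    function e_n of 1, 1/2^2, ..., 1/N^2.  Put m = 2k+1 and
    x_i = (i+1) pi / m for i < k.  By de Moivre's formula the numbers
    - tan^2 x_i are the roots of sum_i C(m,2i+1) X^i, so that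
      e_n(cot^2 x_0, ..., cot^2 x_(k-1)) = C(m,2n+1) / m,
    and multiplying by (pi/m)^(2n) gives a quantity b_k tending to
    pi^(2n) / (2n+1)!.  From x <= tan x on ]0, pi/2[ follows
    (pi/m)^2 cot^2 x_i <= 1/(i+1)^2, hence b_k is at most the truncation at k.
    Conversely (pi/m)^2 cot^2 x_i tends to 1/(i+1)^2 for fixed i, so the
    truncation at N is the limit in k of the e_n of the first N scaled cot^2,
    each of which is at most b_k once k >= N. *)

(** * Elementary symmetric functions through their generating polynomial *)

Definition elemsym (R : nzRingType) (a : nat -> R) (k n : nat) : R :=
  (\prod_(0 <= i < k) (1 + a i *: 'X))`_n.

Lemma elemsym0S (R : comNzRingType) (a : nat -> R) n : elemsym R a 0 n.+1 = 0.
Proof. by rewrite /elemsym big_geq// coef1. Qed.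

Lemma elemsymS (R : comNzRingType) (a : nat -> R) k n :
  elemsym R a k.+1 n.+1 = elemsym R a k n.+1 + a k * elemsym R a k n.
Proof.
by rewrite /elemsym big_nat_recr//= mulrDr mulr1 -scalerAr coefD coefZ coefMX.
Qed.

Lemma elemsym_k0 (R : comNzRingType) (a : nat -> R) k : elemsym R a k 0 = 1.
Proof.
elim: k => [|k IH]; first by rewrite /elemsym big_geq// coef1.
rewrite /elemsym big_nat_recr//= mulrDr mulr1 -scalerAr coefD coefZ coefMX.
by rewrite mulr0 addr0.
Qed.

Lemma elemsym_small (R : comNzRingType) (a : nat -> R) k n :
  (k < n)%N -> elemsym R a k n = 0.
Proof.
elim: k n => [|k IH] [|n]// kn; first exact: elemsym0S.
by rewrite elemsymS !IH ?mulr0 ?addr0// ltnW.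
Qed.

(** Split by the largest index i. Terms with i < n vanish, having too few variables below i, so the
    range starts at n as in the nested sum. *)
Lemma elemsym_sum (R : comNzRingType) (a : nat -> R) k n :
  elemsym R a k n.+1 = \sum_(n <= i < k) a i * elemsym R a i n.
Proof.
elim: k => [|k IH]; first by rewrite elemsym0S big_geq.
rewrite elemsymS; have [nk|kn] := leqP n k; first by rewrite big_nat_recr// IH.
by rewrite !elemsym_small ?mulr0 ?addr0 ?big_geq// ltnW.
Qed.

Lemma elemsymZ (R : comNzRingType) (c : R) (a : nat -> R) k n :
  elemsym R (fun i => c * a i) k n = c ^+ n * elemsym R a k n.
Proof.
elim: k n => [|k IH] [|n]; rewrite ?elemsym_k0 ?elemsym0S ?expr0 ?mulr1 ?mulr0//.
by rewrite !elemsymS !IH exprS; ring.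
Qed.

Lemma elemsym_ge0 (R : numDomainType) (a : nat -> R) k n :
  (forall i, (i < k)%N -> 0 <= a i) -> 0 <= elemsym R a k n.
Proof.
elim: k n => [|k IH] [|n] a0; rewrite ?elemsym_k0 ?elemsym0S ?ler01//.
have a0' i : (i < k)%N -> 0 <= a i by move=> ik; apply: a0; exact: ltnW.
by rewrite elemsymS addr_ge0 ?mulr_ge0 ?a0 ?IH.
Qed.

Lemma ler_elemsym (R : numDomainType) (a b : nat -> R) k n :
  (forall i, (i < k)%N -> 0 <= a i <= b i) -> elemsym R a k n <= elemsym R b k n.
Proof.
elim: k n => [|k IH] [|n] ab; rewrite ?elemsym_k0 ?elemsym0S//.
have ab' i : (i < k)%N -> 0 <= a i <= b i by move=> ik; apply: ab; exact: ltnW.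
have /andP[a0 akbk] := ab k (ltnSn k).
rewrite !elemsymS lerD ?ler_pM ?IH ?elemsym_ge0// => i /ab' /andP[]//.
Qed.

Lemma elemsym_homo (R : numDomainType) (a : nat -> R) j k n :
  (forall i, (i < k)%N -> 0 <= a i) -> (j <= k)%N ->
  elemsym R a j n <= elemsym R a k n.
Proof.
elim: k => [|k IH] a0; first by rewrite leqn0 => /eqP->.
rewrite leq_eqVlt => /predU1P[->//|]; rewrite ltnS => jk.
have a0' i : (i < k)%N -> 0 <= a i by move=> ik; apply: a0; exact: ltnW.
apply: le_trans (IH a0' jk) _; case: n {IH} => [|n]; rewrite ?elemsym_k0// elemsymS.
by rewrite lerDl mulr_ge0 ?a0 ?elemsym_ge0.
Qed.

Lemma cvg_elemsym (R : realType) (T : Type) (F : set_system T) {FF : Filter F}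
    (a : T -> nat -> R) (b : nat -> R) k n :
  (forall i, a t i @[t --> F] --> b i) ->
  elemsym R (a t) k n @[t --> F] --> elemsym R b k n.
Proof.
move=> ab; elim: k n => [|k IH] [|n].
- by under eq_fun do rewrite elemsym_k0; rewrite elemsym_k0; exact: cvg_cst.
- by under eq_fun do rewrite elemsym0S; rewrite elemsym0S; exact: cvg_cst.
- by under eq_fun do rewrite elemsym_k0; rewrite elemsym_k0; exact: cvg_cst.
- under eq_fun do rewrite elemsymS.
  by rewrite elemsymS; apply: cvgD => //; exact: cvgM.
Qed.

(** Peeling off the outermost index is the expansion of e_j by its largest index, after the shift l
    = i + 1; the weight of the indices already chosen factors out. *)
Lemma nested_sum_elemsym (R : realType) j u (ls : seq nat) :
  nested_sum (@inv_prod_sq R) j u.+1 ls =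
  inv_prod_sq R ls * elemsym R (fun i => (i.+1%:R ^+ 2)^-1) u j.
Proof.
elim: j u ls => [|j IH] u ls; first by rewrite elemsym_k0 mulr1.
rewrite /= big_add1 /= elemsym_sum mulr_sumr; apply: eq_bigr => l _.
rewrite IH mulrA; congr (_ * _).
by rewrite /inv_prod_sq big_cons !div1r invfM mulrC.
Qed.

(** * Multiple-angle polynomials *)

Definition binodd (R : nzRingType) m : {poly R} :=
  \poly_(i < m) ('C(m, (2 * i).+1))%:R.

Definition bineven (R : nzRingType) m : {poly R} :=
  \poly_(i < m.+1) ('C(m, 2 * i))%:R.

Lemma coef_binodd (R : nzRingType) m i :
  (binodd R m)`_i = ('C(m, (2 * i).+1))%:R.
Proof.
rewrite coef_poly; case: ltnP => // mi; rewrite bin_small// ltnS mul2n -addnn.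
exact: leq_trans mi (leq_addr _ _).
Qed.

Lemma coef_bineven (R : nzRingType) m i :
  (bineven R m)`_i = ('C(m, 2 * i))%:R.
Proof.
rewrite coef_poly; case: ltnP => // mi; rewrite bin_small// mul2n -addnn.
exact: leq_trans mi (leq_addr _ _).
Qed.

(** Pascal's rule. Along with [binevenS] this is multiplication by 1 + y in (1 + y)^m = E(y^2) + y
    O(y^2), where E is [bineven] and O is [binodd]. *)
Lemma binoddS (R : nzRingType) m : binodd R m.+1 = binodd R m + bineven R m.
Proof.
by apply/polyP => i; rewrite coefD !coef_binodd coef_bineven binS natrD.
Qed.

Lemma binevenS (R : nzRingType) m :
  bineven R m.+1 = bineven R m + 'X * binodd R m.
Proof.
apply/polyP => -[|i]; rewrite coefD coefXM !coef_bineven /= ?muln0 ?bin0 ?addr0//.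
by rewrite coef_binodd !mulnS !add2n binS natrD.
Qed.

(* The imaginary and real parts of (cos x)^m (1 + i tan x)^m. *)
Lemma sin_cos_natmul (R : realType) (x : R) m : cos x != 0 ->
  sin (m%:R * x) = cos x ^+ m * tan x * (binodd R m).[- tan x ^+ 2] /\
  cos (m%:R * x) = cos x ^+ m * (bineven R m).[- tan x ^+ 2].
Proof.
move=> cx; elim: m => [|m [IHs IHc]].
  rewrite mul0r sin0 cos0 expr0 !mul1r; split.
    by rewrite /binodd poly_def big_ord0 horner0 mulr0.
  by rewrite /bineven poly_def big_ord1 bin0 scale1r expr0 hornerC.
have sx : sin x = cos x * tan x by rewrite /tan mulrC divfK.
move: (tan x) sx IHs IHc => t sx IHs IHc.
rewrite -natr1 mulrDl mul1r sinD cosD IHs IHc binoddS binevenS.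
rewrite !hornerE sx (exprS (cos x)).
by split; ring.
Qed.

Lemma binodd_root_tan (R : realType) (x : R) m : cos x != 0 -> sin x != 0 ->
  sin (m%:R * x) = 0 -> root (binodd R m) (- tan x ^+ 2).
Proof.
move=> cx sx; have [-> _] := sin_cos_natmul R x m cx.
move/eqP; rewrite !mulf_eq0 => /orP[/orP[]|//].
  by rewrite expf_eq0 (negbTE cx) andbF.
by rewrite invr_eq0 (negbTE cx) (negbTE sx).
Qed.

Lemma sin_natpi (R : realType) n : sin (n%:R * pi) = 0 :> R.
Proof.
elim: n => [|n IH]; first by rewrite mul0r sin0.
by rewrite -natr1 mulrDl mul1r sinDpi IH oppr0.
Qed.

(** * Roots of the odd polynomial and their symmetric functions *)

Definition angle (R : realType) (k i : nat) : R :=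
  i.+1%:R * pi / (2 * k).+1%:R.

Lemma angle_itv (R : realType) k i : (i < k)%N -> 0 < angle R k i < pi / 2.
Proof.
move=> ik; have p0 := pi_gt0 R; rewrite /angle divr_gt0 ?mulr_gt0//=.
rewrite ltr_pdivrMr// [ltRHS]mulrAC ltr_pdivlMr// [_%:R * pi]mulrC -mulrA ltr_pM2l//.
rewrite -natrM ltr_nat; lia.
Qed.

Lemma angle_inj (R : realType) k : injective (angle R k).
Proof.
move=> i j /mulIf; rewrite invr_eq0 pnatr_eq0 => /(_ isT) /mulIf.
by rewrite gt_eqF ?pi_gt0// => /(_ isT) /eqP; rewrite eqr_nat => /eqP[].
Qed.

Lemma cos_gt0_itv0 (R : realType) (x : R) : 0 <= x < pi / 2 -> 0 < cos x.
Proof.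
move=> /andP[x0 x2]; rewrite cos_gt0_pihalf// x2 andbT (lt_le_trans _ x0)//.
by rewrite oppr_lt0 divr_gt0 ?pi_gt0.
Qed.

Lemma tan_gt0 (R : realType) (x : R) : 0 < x < pi / 2 -> 0 < tan x.
Proof.
move=> /[dup] xI /andP[x0 x2]; rewrite divr_gt0 ?sin_gt0_pihalf//.
by rewrite cos_gt0_itv0// ltW.
Qed.

(** For m = 2k+1 the polynomial is monic of degree k, hence determined by its k distinct roots -
    tan^2 x_i. *)
Lemma binodd_factor (R : realType) k :
  binodd R (2 * k).+1 =
  \prod_(0 <= i < k) ('X + (tan (angle R k i) ^+ 2)%:P).
Proof.
set rs := [seq - tan (angle R k i) ^+ 2 | i <- index_iota 0 k].
(* Cutting the sum at k + 1 exposes the degree and the leading coefficient C(m,m) = 1. *)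
have E : binodd R (2 * k).+1 = \poly_(i < k.+1) ('C((2 * k).+1, (2 * i).+1))%:R.
  apply/polyP => i; rewrite coef_binodd coef_poly; case: ltnP => // ki.
  rewrite bin_small//; lia.
have lc : ('C((2 * k).+1, (2 * k).+1))%:R != 0 :> R by rewrite binn oner_neq0.
rewrite [LHS](@all_roots_prod_XsubC _ _ rs).
- rewrite [in lead_coef _]E lead_coef_poly// binn scale1r big_map.
  by apply: eq_bigr => i _; rewrite polyCN opprK.
- by rewrite E size_poly_eq// size_map size_iota subn0.
- apply/allP => _ /mapP[i + ->]; rewrite mem_index_iota /= => ik.
  have /andP[x0 x2] := angle_itv R k i ik.
  apply: binodd_root_tan.
  + by rewrite gt_eqF// cos_gt0_itv0// ltW.
  + by rewrite gt_eqF// sin_gt0_pihalf// x0.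
  + by rewrite /angle mulrC divfK ?pnatr_eq0// sin_natpi.
(* On ]0, pi/2[ the tangent is positive and injective, so the roots are distinct. *)
- rewrite uniq_rootsE map_inj_in_uniq ?iota_uniq// => i j.
  rewrite !mem_index_iota /= => ik jk /oppr_inj /eqP.
  have ti := tan_gt0 R _ (angle_itv R k i ik).
  have tj := tan_gt0 R _ (angle_itv R k j jk).
  rewrite eqrXn2 ?ltW// => /eqP /tan_inj tij; apply: (angle_inj R k).
  have I l : (l < k)%N -> angle R k l \in `](- (pi / 2)), (pi / 2)[.
    move=> /(angle_itv R) /andP[x0 x2]; rewrite in_itv/= x2 andbT (lt_trans _ x0)//.
    by rewrite oppr_lt0 divr_gt0 ?pi_gt0.
  by apply: tij; exact: I.
Qed.

(** Writing X + t^2 as t^2 (1 + t^-2 X) in each factor makes every coefficient [T] times a symmetric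
    function of the cot^2 x_i; the constant coefficient shows that [T] is m = 2k+1. *)
Lemma elemsym_cot2 (R : realType) k n :
  elemsym R (fun i => (tan (angle R k i) ^+ 2)^-1) k n =
  ('C((2 * k).+1, (2 * n).+1))%:R / (2 * k).+1%:R.
Proof.
set T := \prod_(0 <= i < k) tan (angle R k i) ^+ 2.
have F : binodd R (2 * k).+1 =
    T *: \prod_(0 <= i < k) (1 + (tan (angle R k i) ^+ 2)^-1 *: 'X).
  rewrite binodd_factor -mul_polyC rmorph_prod -big_split /=.
  apply: eq_big_nat => i /= ik.
  have t0 : tan (angle R k i) ^+ 2 != 0.
    by rewrite expf_neq0// gt_eqF// tan_gt0// angle_itv.
  by rewrite mulrDr mulr1 mul_polyC scalerA divff// scale1r addrC.
have C l : ('C((2 * k).+1, (2 * l).+1))%:R =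
    T * elemsym R (fun i => (tan (angle R k i) ^+ 2)^-1) k l.
  by rewrite -coef_binodd F coefZ.
have := C 0; rewrite muln0 bin1 elemsym_k0 mulr1 => ->.
have T0 : T != 0.
  by have := C 0; rewrite muln0 bin1 elemsym_k0 mulr1 => <-; rewrite pnatr_eq0.
by rewrite C mulrC mulKf.
Qed.

(** * Estimates and limits for tangents and scaled cotangents *)

Lemma ler_tan (R : realType) (x : R) : 0 < x < pi / 2 -> x <= tan x.
Proof.
move=> /andP[x0 x2].
have c0 y : y \in `[0, x] -> 0 < cos y.
  by rewrite in_itv/= => /andP[y0 yx]; rewrite cos_gt0_itv0// y0 (le_lt_trans yx).
(* The mean value theorem gives tan x = x / cos^2 c, with 0 < cos c <= 1. *)
have [||c cI] := @MVT R (@tan R) (fun y => (cos y) ^- 2) 0 x x0.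
- move=> y yI; apply: is_derive_tan; rewrite gt_eqF// c0//.
  by apply: subset_itv_oo_cc.
- apply: derivable_within_continuous => y yI; apply: derivable_tan.
  by rewrite gt_eqF// c0.
rewrite tan0 !subr0 => ->; rewrite ler_peMl ?(ltW x0)// -exprVn exprn_ege1//.
by rewrite invf_ge1 ?cos_le1// c0//; apply: subset_itv_oo_cc.
Qed.

(** This is the difference quotient of tan at 0, where the derivative is 1 / cos^2 0 = 1. *)
Lemma cvg_tan_div (R : realType) : (tan x / x : R) @[x --> 0^'] --> (1 : R).
Proof.
have c0 : cos (0 : R) != 0 by rewrite cos0 oner_neq0.
have D := is_derive_tan c0.
have : h^-1 *: ((@tan R \o shift 0) (h *: 1) - tan 0) @[h --> 0^'] -->
    'D_1 (@tan R) 0 := @ex_derive _ _ _ _ _ _ _ D.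
rewrite (@derive_val _ _ _ _ _ _ _ D) cos0 expr1n invr1.
apply: cvg_trans; apply: near_eq_cvg; apply: nearW => h /=.
by rewrite addr0 tan0 subr0 [h *: 1]mulr1 mulrC.
Qed.

Lemma cvg_odd_inv (R : realType) :
  ((2 * k).+1%:R^-1 : R) @[k --> \oo] --> (0 : R).
Proof.
apply: (squeeze_cvgr _ (cvg_cst 0) (@cvg_harmonic R)); near=> k.
rewrite invr_ge0 ler0n/= lef_pV2 ?posrE ?ltr0n// ler_nat; lia.
Unshelve. all: by end_near. Qed.

(** With x the angle, pi / m = x / (i+1), so the term is (x / tan x)^2 / (i+1)^2, and x tends to 0
    from the right. *)
Lemma cvg_cot_angle (R : realType) i :
  (pi / (2 * k).+1%:R) ^+ 2 * (tan (angle R k i) ^+ 2)^-1 @[k --> \oo]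
    --> ((i.+1%:R ^+ 2)^-1 : R).
Proof.
have a0 k : 0 < angle R k i by rewrite /angle divr_gt0 ?mulr_gt0 ?pi_gt0.
have ca : angle R k i @[k --> \oo] --> (0 : R).
  rewrite -(mulr0 (i.+1%:R * pi)); apply: cvgM; [exact: cvg_cst|exact: cvg_odd_inv].
have /cvg_at_rightP/(_ (fun k => angle R k i)) :=
  cvg_dnbhs_at_right (cvg_tan_div R).
move=> /(_ (conj a0 ca)) /(cvgV (oner_neq0 _)) ct.
have /(_ _ _ _) := cvgM (cvg_cst ((i.+1%:R ^+ 2)^-1 : R)) (cvgM ct ct).
rewrite invr1 !mulr1; apply: cvg_trans; apply: near_eq_cvg; apply: nearW => k /=.
have -> : pi / (2 * k).+1%:R = angle R k i / i.+1%:R.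
  by rewrite /angle [RHS]mulrAC [_ * pi]mulrC mulfK ?pnatr_eq0.
rewrite [in RHS]expr_div_n; move: (tan _) => t; move: (angle _ _ _) => x.
rewrite /unstable.inv_fun/= invf_div -!exprVn; ring.
Qed.

(** Each further factor contributes (m - d) / m = 1 - d / m, which tends to 1. *)
Lemma cvg_ffact_odd (R : realType) d :
  ((2 * k).+1 ^_ d)%:R / (2 * k).+1%:R ^+ d @[k --> \oo] --> (1 : R).
Proof.
elim: d => [|d IH].
  by under eq_fun do rewrite ffactn0 expr0 divr1; exact: cvg_cst.
have H : 1 - d%:R * ((2 * k).+1%:R^-1 : R) @[k --> \oo] --> (1 : R).
  rewrite -[X in _ --> X](subr0 1); apply: cvgB; first exact: cvg_cst.
  by rewrite -(mulr0 d%:R); apply: cvgM; [exact: cvg_cst|exact: cvg_odd_inv].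
have /(_ _) := cvgM IH H; rewrite mulr1; apply: cvg_trans; apply: near_eq_cvg.
(* The truncated difference m - d in the naturals is the real one once d <= m. *)
near=> k; have dk : (d <= (2 * k).+1)%N.
  have : (d <= k)%N by near: k; exact: nbhs_infty_ge.
  lia.
rewrite ffactnSr natrM natrB// exprS /=.
have m0 : (2 * k).+1%:R != 0 :> R by rewrite pnatr_eq0.
have md0 := expf_neq0 d m0.
move: m0 md0; move: (_ ^+ d) => md; move: (_.+1%:R) => m m0 md0.
by field; rewrite m0 md0.
Unshelve. all: by end_near. Qed.

(** By the closed form of e_n(cot^2), the term is the limit times m (m-1) ... (m-2n) / m^(2n+1). *)
Lemma cvg_elemsym_cot (R : realType) n :
  elemsym R (fun i => (pi / (2 * k).+1%:R) ^+ 2 * (tan (angle R k i) ^+ 2)^-1) k n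
    @[k --> \oo] --> (pi ^+ (2 * n) / ((2 * n + 1)`!)%:R : R).
Proof.
have /(_ _ _ _) := cvgM (cvg_cst (pi ^+ (2 * n) / ((2 * n + 1)`!)%:R : R))
  (cvg_ffact_odd R (2 * n + 1)).
rewrite mulr1; apply: cvg_trans; apply: near_eq_cvg; apply: nearW => k /=.
rewrite elemsymZ elemsym_cot2 -bin_ffact natrM addn1 -exprM expr_div_n exprS.
have m0 : (2 * k).+1%:R != 0 :> R by rewrite pnatr_eq0.
have md0 := expf_neq0 (2 * n) m0.
have f0 : ((2 * n).+1)`!%:R != 0 :> R by rewrite pnatr_eq0 -lt0n fact_gt0.
by field; rewrite md0 f0 -natrM nat1r m0.
Qed.

(** * Squeezing the truncated sums *)

Theorem mainTheorem1 (R : realType) (n : nat) (hn : (0 < n)%N) :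
  partial_nested_sum R n N @[N --> \oo]
    --> (pi ^+ (2 * n) / ((2 * n + 1)`!)%:R : R).
Proof.
under eq_fun do
  rewrite /partial_nested_sum nested_sum_elemsym /inv_prod_sq big_nil divr1 mul1r.
(* The lower bound is b_N, the upper bound the limit itself. *)
apply: (squeeze_cvgr _ (cvg_elemsym_cot R n) (cvg_cst _)); near=> N.
apply/andP; split.
  apply: ler_elemsym => i iN; have xI := angle_itv R N i iN.
  rewrite mulr_ge0 ?invr_ge0 ?sqr_ge0//=.
  have /andP[x0 _] := xI; have t0 := tan_gt0 R _ xI.
  rewrite ler_pdivrMr ?exprn_gt0// ler_pdivlMl ?exprn_gt0//.
  by rewrite -exprMn mulrA lerXn2r ?nnegrE ?(ltW x0) ?(ltW t0)// ler_tan.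
(* With N fixed, the inequality is obtained by letting k tend to infinity. *)
apply: ler_cvg_to (cvg_elemsym_cot R n) _.
  by apply: cvg_elemsym => i; exact: cvg_cot_angle.
(* For k >= N, passing from N to k nonnegative variables can only increase e_n. *)
near=> k; apply: elemsym_homo => [i _|]; last by near: k; exact: nbhs_infty_ge.
by rewrite mulr_ge0 ?invr_ge0 ?sqr_ge0.
Unshelve. all: by end_near. Qed.
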